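(* Let $\Phi$ be 1-strongly convex with respect to $\|\cdot\|_w$, and let $\{u^k\}$ be obtained from the mirror descent iteration $$\nabla\Phi(u^{k+1})-\nabla\Phi(u^k)=-\eta\big(\nabla f(u^k)+A^\top c(u^k)\big),$$ with stepsize $\eta>0$, where $c(u^k)\in\mathbb R^m$ is the vector such that $Au^{k+1}=b$. Assume that, for some real constant $\mu$, $D_f(u^*,u^k)\ge\mu D_\Phi(u^*,u^k)$ for all $k$. Then $$D_\Phi(u^*,u^{k+1})\le(1-\eta\mu)\,D_\Phi(u^*,u^k)$$ whenever $\eta\le 2\big(f(u^k)-f(u^* )\big)/\|\nabla f(u^k)\|_{w,*}^2$.
   Context: Setting: $\Omega\subset\mathbb R^n$ is convex, $f:\Omega\to\mathbb R$ is a convex differentiable function, $A\in\mathbb R^{m\times n}$, $b\in\mathbb R^m$ ($m\ge 0$; $m=0$ means no constraint). The problem $\min_{u\in\Omega:\,Au=b} f(u)$ is assumed to have a unique solution $u^*$. $\Phi:\Omega\to\mathbb R$ is differentiable. For $h\in\{f,\Phi\}$, $D_h(x,y)=h(x)-h(y)-\langle\nabla h(y),x-y\rangle$ is the Bregman divergence induced by $h$; 1-strong convexity of $\Phi$ with respect to the norm $\|\cdot\|_w$ means $D_\Phi(x,y)\ge\frac12\|x-y\|_w^2$; $\|\cdot\|_{w,*}$ is the dual norm of $\|\cdot\|_w$. The iterates lie in $\Omega$ and the initial point is feasible, so that $Au^k=b$ for all $k$. *)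

(* Defs.v *)
From HB Require Import structures.
From mathcomp Require Import all_boot all_order all_algebra.
From mathcomp Require Import all_classical all_reals topology normedtype landau.
From mathcomp Require Import convex.

Set Implicit Arguments.
Unset Strict Implicit.
Unset Printing Implicit Defensive.

Import Order.TTheory GRing.Theory Num.Theory.
Import numFieldNormedType.Exports.

Local Open Scope classical_set_scope.
Local Open Scope ring_scope.

Section mirror_descent.
Context {R : realType}.

Definition dotv n (x y : 'cV[R]_n) : R := \sum_(i < n) x i 0 * y i 0.

(** Functions on Omega are total functions of which only the values on Omega
    matter. [is_gradient_on Omega h dh] says that h is differentiable on Omega,
    relatively to Omega (which need not be open), with gradient dh. If Omega
    has nonempty interior and is convex, dh is uniquely determined on Omega; if
    Omega is open, this is Frechet differentiability at each point of Omega. *)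
Definition is_gradient_on n (Omega : set 'cV[R]_n) (h : 'cV[R]_n -> R)
    (dh : 'cV[R]_n -> 'cV[R]_n) : Prop :=
  forall x, Omega x ->
    let F := within Omega (nbhs x) in
    (fun y => h y - h x - dotv (dh x) (y - x)) =o_F (fun y => y - x).

Definition bregman n (h : 'cV[R]_n -> R) (dh : 'cV[R]_n -> 'cV[R]_n)
    (x y : 'cV[R]_n) : R :=
  h x - h y - dotv (dh y) (x - y).

(** An arbitrary norm on R^n, not the canonical (sup) norm of ['cV[R]_n];
    nonnegativity follows from the three axioms. *)
Record is_norm n (N : 'cV[R]_n -> R) : Prop := IsNorm {
  is_norm_triangle : forall x y, N (x + y) <= N x + N y;
  is_norm_scale : forall (a : R) x, N (a *: x) = `|a| * N x;
  is_norm_definite : forall x, N x = 0 -> x = 0 }.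

Definition dual_norm n (N : 'cV[R]_n -> R) (y : 'cV[R]_n) : R :=
  sup [set dotv y x | x in [set x | N x <= 1]].

Definition strongly_convex1 n (Omega : set 'cV[R]_n) (N : 'cV[R]_n -> R)
    (Phi : 'cV[R]_n -> R) (dPhi : 'cV[R]_n -> 'cV[R]_n) : Prop :=
  forall x y, Omega x -> Omega y ->
    N (x - y) ^+ 2 / 2 <= bregman Phi dPhi x y.

Definition feasible m n (Omega : set 'cV[R]_n) (A : 'M[R]_(m, n))
    (b : 'cV[R]_m) : set 'cV[R]_n :=
  [set v | Omega v /\ A *m v = b].

Definition is_solution m n (Omega : set 'cV[R]_n) (A : 'M[R]_(m, n))
    (b : 'cV[R]_m) (f : 'cV[R]_n -> R) (v : 'cV[R]_n) : Prop :=
  feasible Omega A b v /\ forall w, feasible Omega A b w -> f v <= f w.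

End mirror_descent.

(* Main.v *)
Require Import Defs.
From HB Require Import structures.
From mathcomp Require Import all_boot all_order all_algebra.
From mathcomp Require Import all_classical all_reals topology normedtype landau.
From mathcomp Require Import convex.
From mathcomp Require Import ring lra.

(** Write g for the gradient of f at u^k, G for its dual norm and d for the step
    u^(k+1) - u^k. The three-point identity [bregman_three_points] reads
      D_Phi(ustar, u^(k+1)) = D_Phi(ustar, u^k) - D_Phi(u^(k+1), u^k)
        - <grad Phi(u^(k+1)) - grad Phi(u^k), ustar - u^(k+1)>.
    The mirror descent equation turns minus the inner product into
    eta <g + A^T c, ustar - u^(k+1)>. As both points satisfy the constraint,
    ustar - u^(k+1) lies in the kernel of A, so the multiplier c disappears:
    the term is eta <g, ustar - u^k> - eta <g, d>.

    By definition of D_f,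
      <g, ustar - u^k> = f(ustar) - f(u^k) - D_f(ustar, u^k),
    and the lower bound mu D_Phi(ustar, u^k) on D_f(ustar, u^k) produces the
    contraction factor. By duality ([dotv_le_dual_norm]) and Young's inequality,
      - eta <g, d> <= (eta G)^2 / 2 + |d|_w^2 / 2,
    and strong convexity lets the term - D_Phi(u^(k+1), u^k) absorb |d|_w^2 / 2.
    What remains is eta (eta G^2 / 2 - (f(u^k) - f(ustar))), and the bound on
    the stepsize says exactly that this is nonpositive. *)

Set Implicit Arguments.
Unset Strict Implicit.
Unset Printing Implicit Defensive.

Import Order.TTheory GRing.Theory Num.Theory.
Import numFieldNormedType.Exports.

Local Open Scope classical_set_scope.
Local Open Scope ring_scope.

Section inner_product.
Context {R : realType}.
Implicit Types n : nat.

Lemma dotvE n (x y : 'cV[R]_n) : dotv x y = (x^T *m y) 0 0.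
Proof. by rewrite mxE; apply: eq_bigr => i _; rewrite mxE. Qed.

Lemma dotvDl n (x y z : 'cV[R]_n) : dotv (x + y) z = dotv x z + dotv y z.
Proof. by rewrite !dotvE linearD mulmxDl mxE. Qed.

Lemma dotvDr n (x y z : 'cV[R]_n) : dotv x (y + z) = dotv x y + dotv x z.
Proof. by rewrite !dotvE mulmxDr mxE. Qed.

Lemma dotvZl n a (x y : 'cV[R]_n) : dotv (a *: x) y = a * dotv x y.
Proof. by rewrite !dotvE linearZ -scalemxAl mxE. Qed.

Lemma dotvZr n a (x y : 'cV[R]_n) : dotv x (a *: y) = a * dotv x y.
Proof. by rewrite !dotvE -scalemxAr mxE. Qed.

Lemma dotvNl n (x y : 'cV[R]_n) : dotv (- x) y = - dotv x y.
Proof. by rewrite -scaleN1r dotvZl mulN1r. Qed.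

Lemma dotvNr n (x y : 'cV[R]_n) : dotv x (- y) = - dotv x y.
Proof. by rewrite -scaleN1r dotvZr mulN1r. Qed.

Lemma dotv0r n (x : 'cV[R]_n) : dotv x 0 = 0.
Proof. by rewrite dotvE mulmx0 mxE. Qed.

Lemma dotv_trmx m n (A : 'M[R]_(m, n)) (x : 'cV[R]_m) (y : 'cV[R]_n) :
  dotv (A^T *m x) y = dotv x (A *m y).
Proof. by rewrite !dotvE trmx_mul trmxK mulmxA. Qed.

End inner_product.

Section dual_norm.
Context {R : realType} (n : nat) (N : 'cV[R]_n -> R).
Hypothesis N_norm : is_norm N.

Lemma is_norm_eq0 : N 0 = 0.
Proof. by rewrite -(scale0r 0) (is_norm_scale N_norm) normr0 mul0r. Qed.

Lemma is_normN x : N (- x) = N x.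
Proof. by rewrite -scaleN1r (is_norm_scale N_norm) normrN1 mul1r. Qed.

Lemma is_norm_ge0 x : 0 <= N x.
Proof.
have := is_norm_triangle N_norm x (- x).
by rewrite subrr is_norm_eq0 is_normN -mulr2n pmulrn_lge0.
Qed.

(** The supremum defining a nonzero dual norm is a genuine one, because [sup]
    takes the value 0 on sets without a supremum; the inequality then follows by
    normalizing x. *)
Lemma dotv_le_dual_norm (y x : 'cV[R]_n) :
  dual_norm N y != 0 -> dotv y x <= dual_norm N y * N x.
Proof.
move=> dual_neq0.
have [Nx0|Nx_neq0] := eqVneq (N x) 0.
  by rewrite (is_norm_definite N_norm Nx0) is_norm_eq0 dotv0r mulr0.
have Nx_gt0 : 0 < N x by rewrite lt_def Nx_neq0 is_norm_ge0.
rewrite -ler_pdivrMr// mulrC -dotvZr.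
apply: sup_upper_bound.
  by apply: contra_notP (elimN eqP dual_neq0) => /sup_out.
exists ((N x)^-1 *: x) => //=.
by rewrite (is_norm_scale N_norm) gtr0_norm ?invr_gt0// mulVf.
Qed.

End dual_norm.

Lemma bregman_three_points (R : realType) n (h : 'cV[R]_n -> R)
    (dh : 'cV[R]_n -> 'cV[R]_n) (x y z : 'cV[R]_n) :
  bregman h dh x z =
    bregman h dh x y - bregman h dh z y - dotv (dh z - dh y) (x - z).
Proof. by rewrite /bregman !(dotvDl, dotvDr, dotvNl, dotvNr); ring. Qed.

Theorem theorem7 (R : realType) (m n : nat)
    (Omega : set 'cV[R]_n) (A : 'M[R]_(m, n)) (b : 'cV[R]_m)
    (f Phi : 'cV[R]_n -> R) (df dPhi : 'cV[R]_n -> 'cV[R]_n)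
    (normw : 'cV[R]_n -> R) (ustar : 'cV[R]_n)
    (u : nat -> 'cV[R]_n) (c : 'cV[R]_n -> 'cV[R]_m) (eta mu : R)
    (Omega_convex : convex_set Omega)
    (f_convex : convex_function Omega f)
    (f_diff : is_gradient_on Omega f df)
    (Phi_diff : is_gradient_on Omega Phi dPhi)
    (ustar_solution : unique (is_solution Omega A b f) ustar)
    (normw_norm : is_norm normw)
    (Phi_strongly_convex : strongly_convex1 Omega normw Phi dPhi)
    (eta_gt0 : 0 < eta)
    (u_in : forall k, Omega (u k))
    (u0_feasible : A *m u 0%N = b)
    (mirror_descent : forall k,
      dPhi (u k.+1) - dPhi (u k) = - (eta *: (df (u k) + A^T *m c (u k))))
    (c_constraint : forall k, A *m u k.+1 = b)
    (mu_ineq : forall k,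
      mu * bregman Phi dPhi ustar (u k) <= bregman f df ustar (u k)) :
  forall k,
    eta <= 2 * (f (u k) - f ustar) / dual_norm normw (df (u k)) ^+ 2 ->
    bregman Phi dPhi ustar (u k.+1) <=
      (1 - eta * mu) * bregman Phi dPhi ustar (u k).
Proof.
move=> k eta_le.
have [[[_ Austar] _] _] := ustar_solution.
have Auk1 := c_constraint k.
set G := dual_norm normw (df (u k)) in eta_le.
(* Division by zero yields 0, which a positive stepsize cannot satisfy. *)
have G_neq0 : G != 0.
  apply: contraTneq eta_le => ->.
  by rewrite expr0n invr0 mulr0 -ltNge.
have etaG2_le : eta * G ^+ 2 <= 2 * (f (u k) - f ustar).
  by rewrite -ler_pdivlMr// exprn_even_gt0.
have multiplier_vanishes :
    dotv (A^T *m c (u k)) (ustar - u k.+1) = 0.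
  by rewrite dotv_trmx mulmxBr Austar Auk1 subrr dotv0r.
have step_dual : dotv (df (u k)) (u k - u k.+1) <= G * normw (u k.+1 - u k).
  rewrite -(is_normN normw_norm) opprB.
  exact: dotv_le_dual_norm.
have strong := Phi_strongly_convex _ _ (u_in k.+1) (u_in k).
have mu_le := mu_ineq k.
set r := normw _ in step_dual strong.
rewrite (bregman_three_points _ _ _ (u k)) mirror_descent.
rewrite dotvNl dotvZl dotvDl multiplier_vanishes addr0.
have -> : dotv (df (u k)) (ustar - u k.+1) =
    f ustar - f (u k) - bregman f df ustar (u k)
    + dotv (df (u k)) (u k - u k.+1).
  by rewrite /bregman !(dotvDr, dotvNr); ring.
have young : 0 <= (eta * G - r) ^+ 2 by exact: sqr_ge0.
have := ler_wpM2l (ltW eta_gt0) step_dual.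
have := ler_wpM2l (ltW eta_gt0) mu_le.
have := ler_wpM2l (ltW eta_gt0) etaG2_le.
move: strong young.
lra.
Qed.
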